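(* Let $\Gamma$ be a straight-line drawing of a graph $G$ whose vertex-ply is $h$. Then the ply of $\Gamma$ is at most $5h$.
   Context: A straight-line drawing of a graph $G=(V,E)$ places each vertex at a distinct point of the plane and draws each edge as the straight-line segment between its endpoints. For each vertex $v$, the ply-disk $D_v$ of $v$ is the open disk centered at $v$ whose radius $r_v$ is half the length of the longest edge incident to $v$. The ply of the drawing is the maximum, over all points $p$ of the plane, of the number of ply-disks containing $p$ in their interior. The vertex-ply of the drawing is the maximum, over all points $p$ at which a vertex of $G$ is placed, of the number of ply-disks containing $p$ in their interior. *)

(* Defs.v *)
From HB Require Import structures.
From mathcomp Require Import all_boot all_order all_algebra.
From mathcomp Require Import boolp reals.

Set Implicit Arguments.
Unset Strict Implicit.
Unset Printing Implicit Defensive.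

Import Order.TTheory GRing.Theory Num.Theory.
Local Open Scope ring_scope.

Record sgraph (V : finType) := SGraph {
  edge : rel V;
  edge_sym : symmetric edge;
  edge_irr : irreflexive edge
}.

(* Edges being straight segments, the drawing is determined by the vertex
   positions; the length of an edge is the distance between its endpoints. *)
Record drawing (R : realType) (V : finType) (G : sgraph V) := Drawing {
  pos :> V -> R * R;
  pos_inj : injective pos
}.

(* The canonical norm on R * R is the sup norm, hence the explicit formula. *)
Definition dist (R : realType) (p q : R * R) : R :=
  Num.sqrt ((p.1 - q.1) ^+ 2 + (p.2 - q.2) ^+ 2).

Section Ply.
Variables (R : realType) (V : finType) (G : sgraph V) (D : drawing R G).

(* This is 0 for an isolated vertex, whose open ply-disk is therefore empty. *)
Definition longest_edge (v : V) : R :=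
  \big[Num.max/0]_(u | edge G v u) dist (D v) (D u).

Definition ply_radius (v : V) : R := longest_edge v / 2.

Definition ply_disk (v : V) : {pred R * R} :=
  [pred p : R * R | dist (D v) p < ply_radius v].

Definition ply_at (p : R * R) : nat := #|[set v | p \in ply_disk v]|.

(* [ply_at] takes values at most #|V|, so this ranges over all its values. *)
Definition ply : nat :=
  (\max_(n < #|V|.+1 | `[< exists p : R * R, ply_at p = n >]) n)%N.

Definition vertex_ply : nat := (\max_(u : V) ply_at (D u))%N.

Lemma ply_at_le_ply (p : R * R) : (ply_at p <= ply)%N.
Proof.
have lt_p : (ply_at p < #|V|.+1)%N by rewrite ltnS max_card.
apply: (@leq_bigmax_cond _ _ (fun n : 'I_(#|V|.+1) => n : nat) (Ordinal lt_p)).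
by apply/asboolP; exists p.
Qed.

Lemma ply_attained : exists p : R * R, ply_at p = ply.
Proof.
have lt_0 : (ply_at (0%R, 0%R) < #|V|.+1)%N by rewrite ltnS max_card.
have P0 : `[< exists p : R * R, ply_at p = Ordinal lt_0 >].
  by apply/asboolP; exists (0%R, 0%R).
rewrite /ply (bigop.bigmax_eq_arg (Ordinal lt_0)) //.
by case: arg_maxnP => // n /asboolP.
Qed.

End Ply.

(* Main.v *)
Require Import Defs.
From mathcomp Require Import all_boot all_order all_algebra.
From mathcomp Require Import reals.
From mathcomp Require Import ring lra.

Set Implicit Arguments.
Unset Strict Implicit.
Unset Printing Implicit Defensive.

Import Order.TTheory GRing.Theory Num.Theory.
Local Open Scope ring_scope.

(** Let [p] be a point of maximal ply. Two points [u], [v] seen from [p] under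
an angle of at most 60 degrees, with [v] at least as close to [p] as [u],
satisfy [|uv| <= |up|]; so if the ply-disk of [u] contains [p], it contains [v].
Let [w] be the vertex nearest to [p] among those whose ply-disk contains [p].
The ray from [p] to [w] is the bisector of a 120 degree sector in which every
such ply-disk contains [w]. The rest of the plane splits into four sectors of
60 degrees, and in each of them the disks contain the vertex nearest to [p] in
that sector. Hence five vertices pierce all disks containing [p]. *)

(** * Hexagonal coordinates *)

(* The squared norm of [x e0 + y e1] for unit vectors [e0], [e1] at 60 degrees. *)
Definition hex_form (F : comPzRingType) (x y : F) : F := x ^+ 2 + x * y + y ^+ 2.

Section HexForm.
Variable F : realFieldType.
Implicit Types x y : F.

Lemma hex_form_ge0 x y : 0 <= hex_form x y.
Proof.
have -> : hex_form x y = (x + y / 2) ^+ 2 + 3 / 4 * y ^+ 2.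
  by rewrite /hex_form; field.
by have := sqr_ge0 (x + y / 2); have := sqr_ge0 y; lra.
Qed.

(* [b] stands for twice the scalar product; the last hypothesis says that the
   angle is at most 60 degrees. *)
Lemma hex_form_sub_le x1 y1 x2 y2
    (b := 2 * x1 * x2 + x1 * y2 + x2 * y1 + 2 * y1 * y2) :
  0 <= b -> hex_form x1 y1 * hex_form x2 y2 <= b ^+ 2 ->
  hex_form x2 y2 <= hex_form x1 y1 ->
  hex_form (x1 - x2) (y1 - y2) <= hex_form x1 y1.
Proof.
move=> b_ge0 angle le21.
have -> : hex_form (x1 - x2) (y1 - y2) = hex_form x1 y1 + (hex_form x2 y2 - b).
  by rewrite /hex_form /b; ring.
(* With [q1], [q2] the two values of [hex_form], it remains that [q2 <= b], which follows from
   [q2 ^+ 2 <= q1 * q2 <= b ^+ 2]. *)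
rewrite gerDl subr_le0 -(ler_pXn2r (n := 2)) ?nnegrE ?hex_form_ge0 //.
by rewrite (le_trans _ angle) // expr2 ler_wpM2r ?hex_form_ge0.
Qed.

(** Nonnegative coordinates describe the 60 degree cone between [e0] and [e1], so two such vectors
    satisfy the angle condition. *)
Lemma hex_form_sub_le_cone x1 y1 x2 y2 :
  0 <= x1 -> 0 <= y1 -> 0 <= x2 -> 0 <= y2 ->
  hex_form x2 y2 <= hex_form x1 y1 ->
  hex_form (x1 - x2) (y1 - y2) <= hex_form x1 y1.
Proof.
move=> x1_ge0 y1_ge0 x2_ge0 y2_ge0; apply: hex_form_sub_le.
  by rewrite !addr_ge0 ?mulr_ge0.
rewrite -subr_ge0.
set d := (X in 0 <= X).
have -> : d = 3 * (x1 ^+ 2 * x2 ^+ 2 + x1 ^+ 2 * x2 * y2 + x1 * y1 * x2 ^+ 2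
    + 3 * (x1 * y1 * x2 * y2) + x1 * y1 * y2 ^+ 2 + y1 ^+ 2 * x2 * y2
    + y1 ^+ 2 * y2 ^+ 2).
  by rewrite /d /hex_form; ring.
by rewrite mulr_ge0 // !addr_ge0 ?mulr_ge0 ?exprn_ge0.
Qed.

(** A 120 degree sector is allowed here because one of the vectors is its bisector [e0]. *)
Lemma hex_form_sub_e0_le x y :
  0 <= x -> 0 <= x + y -> hex_form 1 0 <= hex_form x y ->
  hex_form (x - 1) (y - 0) <= hex_form x y.
Proof.
move=> x_ge0 xy_ge0; apply: hex_form_sub_le.
  by rewrite !mulr1 !mulr0 !mul1r !addr0 mulr2n mulrDl mul1r -addrA addr_ge0.
rewrite -subr_ge0.
set d := (X in 0 <= X).
have -> : d = 3 * (x * (x + y)) by rewrite /d /hex_form; ring.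
by rewrite !mulr_ge0.
Qed.

(* Sector 0 is the 120 degree sector around the direction of [(1, 0)]; sectors
   1, 2, 3 and 4 have 60 degrees and follow it counterclockwise. *)
Definition hex_sector x y : 'I_5 :=
  if 0 <= x then if 0 <= x + y then inord 0 else inord 4
  else if 0 <= y then if 0 <= x + y then inord 1 else inord 2 else inord 3.

Lemma hex_sectorP x y :
  match val (hex_sector x y) with
  | 0 => 0 <= x /\ 0 <= x + y
  | 1 => x <= 0 /\ 0 <= x + y
  | 2 => 0 <= y /\ x + y <= 0
  | 3 => x <= 0 /\ y <= 0
  | _ => 0 <= x /\ x + y <= 0
  end.
Proof.
rewrite /hex_sector; case: (lerP 0 x) => hx; case: (lerP 0 (x + y)) => hxy;
  by case: (lerP 0 y) => hy; rewrite /= inordK //=; lra.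
Qed.

Lemma hex_sector_sub_le x1 y1 x2 y2 :
  hex_sector x1 y1 != ord0 -> hex_sector x1 y1 = hex_sector x2 y2 ->
  hex_form x2 y2 <= hex_form x1 y1 ->
  hex_form (x1 - x2) (y1 - y2) <= hex_form x1 y1.
Proof.
move=> + eq12; have := hex_sectorP x2 y2; have := hex_sectorP x1 y1.
rewrite -val_eqE -eq12; case: (val _) => [|[|[|[|n]]]] //= [h1 h1'] [h2 h2'] _.
(* Each sector is moved onto the cone by a linear isometry of [hex_form]: rotations by -60, -120 and
   180 degrees, then a reflection. *)
- have := @hex_form_sub_le_cone (x1 + y1) (- x1) (x2 + y2) (- x2).
  by rewrite /hex_form; lra.
- have := @hex_form_sub_le_cone y1 (- (x1 + y1)) y2 (- (x2 + y2)).
  by rewrite /hex_form; lra.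
- have := @hex_form_sub_le_cone (- x1) (- y1) (- x2) (- y2).
  by rewrite /hex_form; lra.
- have := @hex_form_sub_le_cone x1 (- (x1 + y1)) x2 (- (x2 + y2)).
  by rewrite /hex_form; lra.
Qed.

End HexForm.

Lemma hex_coordinates (R : realType) (p w : R * R) : w != p ->
  exists (x y : R * R -> R) (c : R),
    [/\ 0 < c, x w - x p = 1, y w - y p = 0 &
        forall u v, dist u v = c * Num.sqrt (hex_form (x u - x v) (y u - y v))].
Proof.
move=> neq_wp; set a := w.1 - p.1; set b := w.2 - p.2.
have n_gt0 : 0 < a ^+ 2 + b ^+ 2.
  rewrite lt0r addr_ge0 ?sqr_ge0 // andbT paddr_eq0 ?sqr_ge0 //.
  rewrite !sqrf_eq0 !subr_eq0.
  by rewrite -pair_eqE in neq_wp.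
have n_neq0 := lt0r_neq0 n_gt0.
set s : R := Num.sqrt 3.
have s2 : s ^+ 2 = 3 by rewrite sqr_sqrtr.
have s_neq0 : s != 0 by rewrite sqrtr_eq0 -ltNge.
set n := a ^+ 2 + b ^+ 2 in n_gt0 n_neq0 *.
(* In units of [|pw|], [X] is the component along [w - p] and [s * Y] the orthogonal one. Since [e1]
   is [(1 / 2, s / 2)] in this frame, the hexagonal coordinates are [X - Y] and [2 * Y]. *)
pose X (u : R * R) := (a * u.1 + b * u.2) / n.
pose Y (u : R * R) := (a * u.2 - b * u.1) / (n * s).
exists (fun u => X u - Y u), (fun u => 2 * Y u), (Num.sqrt n).
have Ywp : Y w - Y p = 0.
  by rewrite /Y -mulrBl (_ : _ - _ = 0) ?mul0r // /a /b; ring.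
have Xwp : X w - X p = 1.
  by rewrite /X -mulrBl (_ : _ - _ = n) ?divff // /n /a /b; ring.
split => [|||u v]; rewrite ?sqrtr_gt0 //.
- by rewrite -[RHS]Xwp; move: Ywp; lra.
- by move: Ywp; lra.
rewrite -sqrtrM ?ltW // /dist; congr Num.sqrt.
set dx := u.1 - v.1; set dy := u.2 - v.2.
have -> : X u - Y u - (X v - Y v) =
    (a * dx + b * dy) / n - (a * dy - b * dx) / (n * s).
  by rewrite /X /Y /dx /dy; field; rewrite s_neq0.
have -> : 2 * Y u - 2 * Y v = 2 * ((a * dy - b * dx) / (n * s)).
  by rewrite /Y /dx /dy; field; rewrite s_neq0.
rewrite /hex_form; set P := _ / n; set Q := _ / (n * s).
have -> : (P - Q) ^+ 2 + (P - Q) * (2 * Q) + (2 * Q) ^+ 2 = P ^+ 2 + 3 * Q ^+ 2.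
  by ring.
have -> : 3 * Q ^+ 2 = ((a * dy - b * dx) / n) ^+ 2.
  by rewrite -s2 /Q; field; rewrite n_neq0.
by rewrite /P /n; field.
Qed.

(** * Piercing the ply-disks *)

Section Ply.
Variables (R : realType) (V : finType) (G : sgraph V) (D : drawing R G).

Lemma pierced_card_le (A : {set V}) :
  (exists w, forall u, u \in A -> D w \in ply_disk D u) ->
  (#|A| <= vertex_ply D)%N.
Proof.
case=> w Aw; apply: leq_trans (leq_bigmax w).
by apply/subset_leq_card/subsetP => u uA; rewrite inE Aw.
Qed.

Lemma ply_disk_closer p w u : p \in ply_disk D u ->
  dist (D u) (D w) <= dist (D u) p -> D w \in ply_disk D u.
Proof. by rewrite !inE => + le_d; apply: le_lt_trans. Qed.

Lemma nearest_exists (A : {set V}) p v : v \in A ->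
  exists2 w, w \in A & forall u, u \in A -> dist (D w) p <= dist (D u) p.
Proof. by case/(arg_minP (fun u => dist (D u) p)) => w; exists w. Qed.

Lemma ply_at_le p : (ply_at D p <= 5 * vertex_ply D)%N.
Proof.
rewrite /ply_at; set S := [set v | _].
have [-> | [v0 v0S]] := set_0Vmem S; first by rewrite cards0.
have [w wS w_min] := nearest_exists p v0S.
(* If [w] lies at [p], there is no direction to bisect, but [w] alone pierces every disk. *)
have [eq_wp | neq_wp] := eqVneq (D w) p.
  apply: leq_trans (leq_pmull _ (isT : 0 < 5)%N).
  by apply: pierced_card_le; exists w => u; rewrite eq_wp inE.
have [x [y [c [c_gt0 xwp ywp distE]]]] := hex_coordinates neq_wp.
have dist_le u v u' v' : (dist u v <= dist u' v') =
    (hex_form (x u - x v) (y u - y v) <= hex_form (x u' - x v') (y u' - y v')).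
  by rewrite !distE ler_pM2l // ler_sqrt ?hex_form_ge0.
pose sector u := hex_sector (x (D u) - x p) (y (D u) - y p).
have -> : #|S| = (\sum_(i < 5) #|[set u in S | sector u == i]|)%N.
  rewrite -sum1_card (partition_big sector xpredT) //=.
  by apply: eq_bigr => i _; rewrite -sum1_card; apply: eq_bigl => u; rewrite inE.
rewrite -[X in (_ <= X * _)%N]card_ord -sum_nat_const; apply: leq_sum => i _.
have [-> | [v1 v1T]] := set_0Vmem [set u in S | sector u == i].
  by rewrite cards0.
apply: pierced_card_le.
(* Differences are recentred at [p], from which the sectors are seen. *)
have subE (t : R * R -> R) u v : t u - t v = (t u - t p) - (t v - t p) by ring.
have [-> | i_neq0] := eqVneq i ord0.
  exists w => u; rewrite inE => /andP[uS /eqP su].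
  apply: (@ply_disk_closer p); first by rewrite inE in uS.
  have := hex_sectorP (x (D u) - x p) (y (D u) - y p); rewrite -/(sector u) su /=.
  case=> ux uxy; rewrite dist_le (subE x) (subE y _ (D w)) xwp ywp.
  by apply: hex_form_sub_e0_le => //; have := w_min u uS; rewrite dist_le xwp ywp.
have [v] := nearest_exists p v1T.
rewrite inE => /andP[_ /eqP sv] v_min.
exists v => u uT; have := v_min u uT; move: uT.
rewrite inE => /andP[uS /eqP su] le_vu.
apply: (@ply_disk_closer p); first by rewrite inE in uS.
rewrite dist_le (subE x) (subE y _ (D v)); rewrite dist_le in le_vu.
by apply: hex_sector_sub_le => //; rewrite -/(sector _) su // -sv.
Qed.

End Ply.

Theorem theorem1 (R : realType) (V : finType) (G : sgraph V)
    (Gamma : drawing R G) (h : nat) :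
  vertex_ply Gamma = h -> (ply Gamma <= 5 * h)%N.
Proof. by move=> <-; have [p <-] := ply_attained Gamma; apply: ply_at_le. Qed.
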